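(* Let $N\ge 1$ and let $a_n<b_n$ be real numbers for $1\le n\le N^2$. Let $L=\sup_{n}(b_n-a_n)$. Then for all $\boldsymbol\tau(1),\boldsymbol\tau(2)\in\mathbb R^{N^2}$, $$\|\boldsymbol\xi(\boldsymbol\tau(1))-\boldsymbol\xi(\boldsymbol\tau(2))\|_2\le \frac L2\, d_M(\boldsymbol\tau(1),\boldsymbol\tau(2)),$$ $$\frac1N\|\boldsymbol\xi(\boldsymbol\tau(1))-\boldsymbol\xi(\boldsymbol\tau(2))\|_1\le \frac L2\, d_M(\boldsymbol\tau(1),\boldsymbol\tau(2)),$$ $$\sup_n|\xi_n(\tau_n(1))-\xi_n(\tau_n(2))|\le \frac L2\,\sup_n|h_n(\tau_n(1))-h_n(\tau_n(2))|.$$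
   Context: For $1\le n\le N^2$ and $\tau\in\mathbb R$ put $M_n(\tau)=\ln\big(e^{-a_n\tau}+e^{-b_n\tau}\big)$, $$\xi_n(\tau)=-M_n'(\tau)=\frac{a_ne^{-a_n\tau}+b_ne^{-b_n\tau}}{e^{-a_n\tau}+e^{-b_n\tau}},\qquad h_n(\tau)=2\arctan\big(e^{(b_n-a_n)\tau/2}\big).$$ For $\boldsymbol\tau=(\tau_1,\dots,\tau_{N^2})\in\mathbb R^{N^2}$ put $\boldsymbol\xi(\boldsymbol\tau)=(\xi_n(\tau_n))_{n}$. The components of $\boldsymbol\tau(i)$ are denoted $\tau_n(i)$, $i=1,2$. The geodesic distance on $\mathbb R^{N^2}$ for the Riemannian metric given by the (diagonal) Hessian of $M(\boldsymbol\tau)=\sum_n M_n(\tau_n)$ is $$d_M(\boldsymbol\tau(1),\boldsymbol\tau(2))=\Big(\sum_{n=1}^{N^2}\big(h_n(\tau_n(1))-h_n(\tau_n(2))\big)^2\Big)^{1/2}.$$ $\|\cdot\|_1$ and $\|\cdot\|_2$ are the usual $\ell^1$ and $\ell^2$ norms on $\mathbb R^{N^2}$. *)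

(* Defs.v *)
From mathcomp Require Import all_boot all_order all_algebra.
From mathcomp Require Import all_classical all_reals all_analysis.
From mathcomp Require Import ring.
Import Order.TTheory GRing.Theory Num.Theory.
Import numFieldNormedType.Exports.

Set Implicit Arguments.
Unset Strict Implicit.
Unset Printing Implicit Defensive.

Local Open Scope classical_set_scope.
Local Open Scope ring_scope.

Section OneDimensional.
Variable R : realType.
Implicit Types a b t : R.

Definition M1 a b t : R := ln (expR (- a * t) + expR (- b * t)).

Definition xi1 a b t : R := - derive1 (M1 a b) t.

Definition h1 a b t : R := 2 * atan (expR ((b - a) * t / 2)).

Let is_derive_expRM c t :
  is_derive t 1 (fun s : R => expR (c * s)) (c * expR (c * t)).
Proof.
have D : is_derive t 1 (fun s : R => c * s) c.
  rewrite -[X in is_derive _ _ _ X](mulr1 c).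
  exact: (@is_deriveZ _ _ _ id c t 1 1).
rewrite mulrC; exact: (@is_derive1_comp _ expR _ t).
Qed.

Lemma is_derive_M1 a b t :
  is_derive t 1 (M1 a b)
    (- ((a * expR (- a * t) + b * expR (- b * t)) /
        (expR (- a * t) + expR (- b * t)))).
Proof.
have pos : 0 < expR (- a * t) + expR (- b * t).
  by rewrite addr_gt0 ?expR_gt0.
have Dln := is_derive1_ln pos.
have De := is_deriveD (is_derive_expRM (- a) t) (is_derive_expRM (- b) t).
have D := @is_derive1_comp _ (@ln R) _ t _ _ Dln De.
apply: (is_derive_eq D).
by field; rewrite gt_eqF.
Qed.

Lemma xi1E a b t :
  xi1 a b t = (a * expR (- a * t) + b * expR (- b * t)) /
              (expR (- a * t) + expR (- b * t)).
Proof.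
have D := is_derive_M1 a b t.
by rewrite /xi1 derive1E derive_val opprK.
Qed.

(* The metric coefficient M'' is the square of h', so the geodesic distance of
   the Hessian metric is Euclidean in the coordinates h. *)
Lemma derive1_h1_sqr a b t : (derive1 (h1 a b) t) ^+ 2 = derive1n 2 (M1 a b) t.
Proof.
set A := expR (- a * t); set B := expR (- b * t).
have A0 : 0 < A by exact: expR_gt0.
have B0 : 0 < B by exact: expR_gt0.
have AB0 : A + B != 0 by rewrite gt_eqF ?addr_gt0.
have -> : derive1n 2 (M1 a b) t = (b - a) ^+ 2 * A * B / (A + B) ^+ 2.
  have -> : derive1n 2 (M1 a b) = derive1 (fun s : R =>
      - ((a * expR (- a * s) + b * expR (- b * s)) *
         (expR (- a * s) + expR (- b * s))^-1)).
    rewrite derive1nS derive1n1; congr derive1; apply/funext => s.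
    by have D := is_derive_M1 a b s; rewrite derive1E derive_val.
  have Da := is_derive_expRM (- a) t.
  have Db := is_derive_expRM (- b) t.
  have Dnum := is_deriveD (is_deriveZ a Da) (is_deriveZ b Db).
  have Dden := is_deriveD Da Db.
  have Dinv := is_deriveV (AB0 : ((fun s : R => expR (- a * s)) +
    (fun s : R => expR (- b * s))) t != 0) Dden.
  have D := is_deriveN (is_deriveM Dnum Dinv).
  rewrite derive1E (@derive_val _ _ _ _ _ _ _ D) /GRing.scale /=.
  rewrite -[in LHS]/A.
  change (- ((a * A + b * B) * (- (A + B) ^- 2 * (- a * A + - b * B)) +
    (A + B)^-1 * (a * (- a * A) + b * (- b * B))) =
    (b - a) ^+ 2 * A * B / (A + B) ^+ 2).
  by field.
set E := expR ((b - a) * t / 2).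
have E0 : 0 < E by exact: expR_gt0.
have EAB : A = E ^+ 2 * B.
  by rewrite /A /E /B -expRM_natl -expRD; congr expR; field.
have Dl : is_derive t 1 (fun s : R => (b - a) * s / 2) ((b - a) / 2).
  have -> : (fun s : R => (b - a) * s / 2) = (((b - a) / 2) \*: (@id R)).
    by apply/funext => s /=; rewrite /GRing.scale /=; field.
  rewrite -[X in is_derive _ _ _ X]mulr1.
  exact: (@is_deriveZ _ _ _ id ((b - a) / 2) t 1 1).
have DE := @is_derive1_comp _ expR _ t _ _ (is_derive_expR _) Dl.
have Dat := @is_derive1_comp _ (@atan R) _ t _ _ (is_derive1_atan _) DE.
have Dh := is_deriveZ (2 : R) Dat.
rewrite derive1E (@derive_val _ _ _ _ _ _ _ Dh) /GRing.scale /=.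
rewrite -/E EAB.
have E1 : 1 + E ^+ 2 != 0 by rewrite gt_eqF// ltr_pwDl// sqr_ge0.
field.
by rewrite E1 -EAB AB0.
Qed.

End OneDimensional.

Section Vectors.
Variables (R : realType) (n : nat).

Definition norm_l1 (x : 'rV[R]_n) : R := \sum_i `|x 0 i|.

Definition norm_l2 (x : 'rV[R]_n) : R := Num.sqrt (\sum_i `|x 0 i| ^+ 2).

Variables a b : 'I_n -> R.

Definition xi (tau : 'rV[R]_n) : 'rV[R]_n :=
  \row_i xi1 (a i) (b i) (tau 0 i).

(* Closed form of the geodesic distance of the diagonal metric
   diag (M1 (a i) (b i))^`(2), see derive1_h1_sqr. *)
Definition d_M (tau1 tau2 : 'rV[R]_n) : R :=
  Num.sqrt (\sum_i
    (h1 (a i) (b i) (tau1 0 i) - h1 (a i) (b i) (tau2 0 i)) ^+ 2).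

End Vectors.

(* Main.v *)
(* The mean value of a two-point Gibbs distribution is affine in the cosine of the
   geodesic coordinate: xi1 = (a + b) / 2 + (b - a) / 2 * cos h1.  The cosine being
   1-Lipschitz, each component of xi is (b - a) / 2-Lipschitz in h1; the norm
   inequalities follow by monotonicity and by norm_l1 <= N * norm_l2 in dimension N ^ 2. *)
Require Import Defs.
From mathcomp Require Import all_boot all_order all_algebra.
From mathcomp Require Import all_classical all_reals all_analysis.
From mathcomp Require Import ring.
Import Order.TTheory GRing.Theory Num.Theory.
Import numFieldNormedType.Exports.

Local Open Scope classical_set_scope.
Local Open Scope ring_scope.

(** Mean value theorem: the derivative [- sin] has modulus at most 1. *)
Lemma dist_cos_le (R : realType) (x y : R) : `|cos x - cos y| <= `|x - y|.
Proof.
wlog le_xy : x y / x <= y.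
  move=> H; case/orP: (le_total x y) => [|le_yx]; first exact: H.
  by rewrite distrC (distrC x); exact: H.
have [|c _ E] := @MVT_segment R (@cos R) (fun t => - sin t) x y le_xy.
  exact/continuous_subspaceT/continuous_cos.
rewrite distrC E normrM normrN (distrC x) ler_piMl//.
by rewrite ler_norml sin_geN1 sin_le1.
Qed.

(** Double-angle formula [2 * cos u ^+ 2 - 1] at [u = atan x], where [cos u] is the inverse of the
    square root of [1 + x ^+ 2]. *)
Lemma cos_double_atan (R : realType) (x : R) :
  cos (2 * atan x) = 2 / (1 + x ^+ 2) - 1.
Proof.
have x1 : 0 <= 1 + x ^+ 2 by rewrite addr_ge0 ?sqr_ge0.
by rewrite mulr_natl cos_mulr2n cos_atan exprVn sqr_sqrtr// mulr_natl.
Qed.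

(** With [E = expR ((b - a) * t)], the Gibbs weights of [a] and [b] are [E / (1 + E)] and
    [1 / (1 + E)]. The second minus the first is [2 / (1 + E) - 1], which is [cos (h1 a b t)]. *)
Lemma xi1_cos_h1 (R : realType) (a b t : R) :
  xi1 a b t = (a + b) / 2 + (b - a) / 2 * cos (h1 a b t).
Proof.
rewrite xi1E /h1 cos_double_atan -expRM_natl.
have -> : expR (- a * t) = expR (2 * ((b - a) * t / 2)) * expR (- b * t).
  by rewrite -expRD; congr expR; field.
set E := expR (2 * _); set B := expR (- b * t).
have E0 : 0 < E by exact: expR_gt0.
have B0 : 0 < B by exact: expR_gt0.
by field; rewrite !gt_eqF ?addr_gt0 ?mulr_gt0.
Qed.

Lemma dist_xi1_le (R : realType) (a b s t : R) : a <= b ->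
  `|xi1 a b s - xi1 a b t| <= (b - a) / 2 * `|h1 a b s - h1 a b t|.
Proof.
move=> le_ab; have ab0 : 0 <= (b - a) / 2 by rewrite divr_ge0 ?subr_ge0.
rewrite !xi1_cos_h1 opprD addrACA subrr add0r -mulrBr normrM ger0_norm//.
by rewrite ler_wpM2l// dist_cos_le.
Qed.

Lemma norm_l2_ge0 (R : realType) (n : nat) (x : 'rV[R]_n) : 0 <= norm_l2 x.
Proof. exact: sqrtr_ge0. Qed.

Lemma sqr_norm_l2 (R : realType) (n : nat) (x : 'rV[R]_n) :
  norm_l2 x ^+ 2 = \sum_i `|x 0 i| ^+ 2.
Proof. by rewrite sqr_sqrtr// sumr_ge0// => i _; rewrite sqr_ge0. Qed.

(** Cauchy-Schwarz against the all-ones vector. *)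
Lemma norm_l1_le_norm_l2 (R : realType) (n : nat) (x : 'rV[R]_n) :
  norm_l1 x <= Num.sqrt n%:R * norm_l2 x.
Proof.
(* The dimension is cancelled as a positive factor below, so dimension 0 is treated apart. *)
case: n x => [|n] x.
  by rewrite /norm_l1 big_ord0 mulr_ge0 ?sqrtr_ge0.
set m : R := n.+1%:R; have m0 : 0 < m by rewrite ltr0n.
rewrite /norm_l1; set S := \sum_i `|x 0 i|; set Q := \sum_i `|x 0 i| ^+ 2.
have S0 : 0 <= S by apply: sumr_ge0.
(* The variance of the moduli of the entries is nonnegative. *)
have : 0 <= \sum_i (m * `|x 0 i| - S) ^+ 2 by apply: sumr_ge0 => i _; rewrite sqr_ge0.
have -> : \sum_i (m * `|x 0 i| - S) ^+ 2 = m * (m * Q - S ^+ 2).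
  transitivity (\sum_i (m ^+ 2 * `|x 0 i| ^+ 2 - 2 * m * S * `|x 0 i| + S ^+ 2)).
    by apply: eq_bigr => i _; ring.
  rewrite big_split/= sumrB -!mulr_sumr -/Q sumr_const card_ord -/S -[S *+ _]mulr_natl -/m.
  by ring.
rewrite pmulr_rge0// subr_ge0 => SQ.
rewrite -(@ler_pXn2r _ 2) ?nnegrE ?mulr_ge0 ?sqrtr_ge0 ?norm_l2_ge0//.
by rewrite exprMn sqr_norm_l2 sqr_sqrtr ?ler0n.
Qed.

Lemma ler_sup_ord (R : realType) (n : nat) (f : 'I_n -> R) (i : 'I_n) :
  f i <= sup [set f j | j in [set: 'I_n]].
Proof.
apply: ub_le_sup; last by exists i.
(* A finite family is bounded above by its maximum; the seed 0 can only enlarge this bound. *)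
exists (\big[Num.max/0]_j f j) => _ [j _ <-]; exact: le_bigmax.
Qed.

Theorem theorem3p2 (R : realType) (N : nat) (hN : (1 <= N)%N)
    (a b : 'I_(N ^ 2)%N -> R) (hab : forall n, a n < b n)
    (tau1 tau2 : 'rV[R]_(N ^ 2)%N) :
  let L := sup [set b n - a n | n in [set: 'I_(N ^ 2)%N]] in
  [/\ norm_l2 (xi a b tau1 - xi a b tau2) <= L / 2 * d_M a b tau1 tau2,
      N%:R^-1 * norm_l1 (xi a b tau1 - xi a b tau2)
        <= L / 2 * d_M a b tau1 tau2
    & sup [set `|xi1 (a n) (b n) (tau1 0 n) - xi1 (a n) (b n) (tau2 0 n)|
             | n in [set: 'I_(N ^ 2)%N]]
        <= L / 2 *
           sup [set `|h1 (a n) (b n) (tau1 0 n) - h1 (a n) (b n) (tau2 0 n)|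
                  | n in [set: 'I_(N ^ 2)%N]]].
Proof.
move=> L.
have le_L n : b n - a n <= L by exact: (ler_sup_ord _ _ (fun n => b n - a n)).
(* An index exists because [1 <= N]. It serves twice: for [0 <= L / 2], and for the nonemptiness
   that bounding a [sup] from above requires. *)
have i0 : 'I_(N ^ 2)%N by exists 0%N; rewrite expn_gt0 hN.
have L0 : 0 <= L / 2.
  by rewrite divr_ge0// (le_trans _ (le_L i0))// subr_ge0 ltW.
have lip n : `|xi1 (a n) (b n) (tau1 0 n) - xi1 (a n) (b n) (tau2 0 n)| <=
    L / 2 * `|h1 (a n) (b n) (tau1 0 n) - h1 (a n) (b n) (tau2 0 n)|.
  rewrite (le_trans (dist_xi1_le _ _ _ _ _ (ltW (hab n))))//.
  by rewrite ler_wpM2r// ler_pM2r ?le_L// invr_gt0.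
have l2 : norm_l2 (xi a b tau1 - xi a b tau2) <= L / 2 * d_M a b tau1 tau2.
  (* Both sides are nonnegative, so their squares are compared, and these term by term with
     [lip]. *)
  rewrite -(@ler_pXn2r _ 2) ?nnegrE ?norm_l2_ge0//; last first.
    by rewrite mulr_ge0// sqrtr_ge0.
  rewrite sqr_norm_l2 exprMn sqr_sqrtr; last first.
    by apply: sumr_ge0 => i _; rewrite sqr_ge0.
  rewrite mulr_sumr; apply: ler_sum => i _; rewrite !mxE.
  rewrite -(real_normK (num_real (h1 _ _ _ - _))) -exprMn.
  by apply: lerXn2r (lip i); rewrite nnegrE// mulr_ge0.
split=> //.
- apply: le_trans l2; rewrite ler_pdivrMl ?ltr0n//.
  (* In dimension [N ^ 2] the factor [Num.sqrt n%:R] is exactly [N], which the normalisation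
     [N%:R^-1] absorbs. *)
  by rewrite (le_trans (norm_l1_le_norm_l2 _ _ _))// natrX sqrtr_sqr normr_nat.
- apply: ge_sup; first by eexists; exists i0.
  move=> _ [n _ <-]; rewrite (le_trans (lip n))// ler_wpM2l//.
  exact: (ler_sup_ord _ _ (fun n => `|h1 (a n) (b n) (tau1 0 n) - _|)).
Qed.
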